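(* Let $N$ be a positive integer and let $k$ be a field. Let $M$ be an $N$-complex of finite dimensional $k$-vector spaces which is zero at small enough objects (i.e. there is $b\in\mathbb{Z}$ with ${}_iM=0$ for all $i\le b$) and which does not have nonzero projective direct summands. Then the dimensions of its amplitude cohomology determine the multiplicities of each indecomposable direct summand. That is: if $M$ and $M'$ are two such $N$-complexes with $\dim_k(AH)_a^i(M)=\dim_k(AH)_a^i(M')$ for all $i\in\mathbb{Z}$ and all $1\le a\le N-1$, then for every $i\in\mathbb{Z}$ and $0\le l\le N-1$ the multiplicity of $M_i^l$ as an indecomposable direct summand is the same in $M$ and in $M'$.
   Context: An $N$-complex is a $\mathbb{Z}$-graded $k$-vector space $\{{}_iM\}_{i\in\mathbb{Z}}$ together with linear maps $d_i:{}_iM\to{}_{i+1}M$ such that $d_{i+N-1}\circ\dots\circ d_i=0$ for each $i\in\mathbb{Z}$. Morphisms are degree-preserving linear maps commuting with the $d_i$; projective refers to the category of $N$-complexes. For $i\in\mathbb{Z}$ and $0\le l\le N-1$, $M_i^l$ is the indecomposable $N$-complex with ${}_j(M_i^l)=k$ for $i\le j\le i+l$ and ${}_j(M_i^l)=0$ otherwise, where $d_i,\dots,d_{i+l-1}$ are the identity and all other $d_j$ are zero. Every $N$-complex $M$ of finite dimensional vector spaces is isomorphic to $\bigoplus_{i\in\mathbb{Z},\,0\le l\le N-1}n_i^lM_i^l$ for a unique family of non-negative integers $n_i^l$, the multiplicities of the indecomposable direct summands. For $1\le a\le N-1$ and $i\in\mathbb{Z}$, the amplitude cohomology is $$(AH)_a^i(M):=\ker(d_{i+a-1}\circ\dots\circ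 d_i)/\mathrm{im}(d_{i-1}\circ\dots\circ d_{i-N+a}).$$ *)

(* Defs.v *)
From HB Require Import structures.
From mathcomp Require Import all_boot all_order all_algebra.
From mathcomp Require Import generic_quotient ring_quotient.
From mathcomp Require Import zify.
From mathcomp Require Import boolp.

Set Implicit Arguments.
Unset Strict Implicit.
Unset Printing Implicit Defensive.

Import Order.TTheory GRing.Theory Num.Theory.

Local Open Scope ring_scope.
Local Open Scope quotient_scope.

(* The quotient vT / W of a finite dimensional space by a subspace, carried by
   the library's quotient of additive groups. *)
Section QuotientSpace.
Variables (k : fieldType) (vT : vectType k) (W : {vspace vT}).

Definition quot_space : Type := Quotient.quot (pred_of_vspace W).

HB.instance Definition _ := GRing.Zmodule.on quot_space.

Definition quot_proj (x : vT) : quot_space := \pi_(Quotient.quot (pred_of_vspace W)) x.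

Lemma quot_projP x y : quot_proj x = quot_proj y <-> x - y \in W.
Proof.
rewrite /quot_proj.
by split=> [/eqP|xyW]; [|apply/eqP]; rewrite -Quotient.idealrBE.
Qed.

Lemma quot_proj_repr (u : quot_space) :
  quot_proj (repr (u : Quotient.quot (pred_of_vspace W))) = u.
Proof. exact: reprK. Qed.

Lemma quot_projB : {morph quot_proj : x y / x - y}.
Proof. exact: (raddfB \pi_(Quotient.quot (pred_of_vspace W))). Qed.

Lemma quot_projD : {morph quot_proj : x y / x + y}.
Proof. exact: (raddfD \pi_(Quotient.quot (pred_of_vspace W))). Qed.

Definition quot_scale (a : k) (u : quot_space) : quot_space :=
  quot_proj (a *: repr (u : Quotient.quot (pred_of_vspace W))).

Lemma quot_scaleE a x : quot_scale a (quot_proj x) = quot_proj (a *: x).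
Proof.
apply/quot_projP; rewrite -scalerBr memvZ //.
by apply/quot_projP; rewrite quot_proj_repr.
Qed.

Fact quot_scaleA a b u : quot_scale a (quot_scale b u) = quot_scale (a * b) u.
Proof. by rewrite -[u]quot_proj_repr !quot_scaleE scalerA. Qed.
Fact quot_scale1 : left_id 1 quot_scale.
Proof. by move=> u; rewrite -[u]quot_proj_repr quot_scaleE scale1r. Qed.
Fact quot_scaleDr : right_distributive quot_scale +%R.
Proof.
move=> a u v; rewrite -[u]quot_proj_repr -[v]quot_proj_repr.
by rewrite -quot_projD !quot_scaleE scalerDr quot_projD.
Qed.
Fact quot_scaleDl u : {morph quot_scale^~ u : a b / a + b}.
Proof.
by move=> a b; rewrite -[u]quot_proj_repr !quot_scaleE scalerDl quot_projD.
Qed.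

HB.instance Definition _ := GRing.Zmodule_isLmodule.Build k quot_space
  quot_scaleA quot_scale1 quot_scaleDr quot_scaleDl.

Fact quot_proj_linear : linear quot_proj.
Proof. by move=> a x y; rewrite quot_projD -quot_scaleE. Qed.

HB.instance Definition _ :=
  GRing.isLinear.Build k vT quot_space *:%R quot_proj quot_proj_linear.

Fact quot_space_vect_iso : Vector.axiom (\dim (W^C)%VS) quot_space.
Proof.
pose p : 'End(vT) := daddv_pi (W^C)%VS W.
have dxW : (W^C :&: W = 0)%VS by rewrite capvC capv_compl.
have pC x : p x \in (W^C)%VS by exact: memv_pi.
have p0 x : (x \in W) = (p x == 0).
  have xT : x \in (W^C + W)%VS by rewrite addvC addv_complf memvf.
  have dE := daddv_pi_add dxW xT.
  apply/idP/eqP => [xW | px0].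
    have dyW : (W :&: W^C = 0)%VS by rewrite capv_compl.
    have := daddv_pi_id dyW xW => h.
    by apply: (addIr (daddv_pi W W^C x)); rewrite /p dE add0r h.
  by move: dE; rewrite -/p px0 add0r => <-; exact: memv_pi.
case: (subvs_vect_iso (W^C)%VS) => g glin gbij.
pose f (u : quot_space) :=
  g (vsproj (W^C)%VS (p (repr (u : Quotient.quot (pred_of_vspace W))))).
have fE x : f (quot_proj x) = g (vsproj (W^C)%VS (p x)).
  rewrite /f; congr (g (vsproj _ _)); apply/eqP.
  by rewrite -subr_eq0 -linearB -p0; apply/quot_projP; rewrite quot_proj_repr.
exists f.
  move=> a u v; rewrite -[u]quot_proj_repr -[v]quot_proj_repr.
  by rewrite -quot_proj_linear !fE !linearP glin.
case: gbij => h gK hK.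
exists (fun r => quot_proj (vsval (h r))) => [u|r].
  rewrite -[u]quot_proj_repr fE gK vsprojK //.
  apply/quot_projP; rewrite p0 linearB subr_eq0 /=.
  by rewrite /p (daddv_pi_id dxW (pC _)).
by rewrite fE /p (daddv_pi_id dxW (subvsP _)) vsvalK hK.
Qed.

HB.instance Definition _ :=
  Lmodule_hasFinDim.Build k quot_space quot_space_vect_iso.

Lemma dim_quot_space : \dim {: quot_space} = (\dim {: vT} - \dim W)%N.
Proof. by rewrite -dimv_compl dimvf. Qed.

End QuotientSpace.

(* Direct sums of arbitrary families of vector spaces: finitely supported
   dependent functions. *)
Section DirectSum.
Variables (k : fieldType) (I : Type) (V : I -> lmodType k).

Definition dprod : Type := forall i, V i.
HB.instance Definition _ := Choice.on dprod.

Fact dprod_addA : associative (fun f g : dprod => (fun i => f i + g i) : dprod).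
Proof. by move=> f g h; apply: functional_extensionality_dep => i; rewrite addrA. Qed.
Fact dprod_addC : commutative (fun f g : dprod => (fun i => f i + g i) : dprod).
Proof. by move=> f g; apply: functional_extensionality_dep => i; rewrite addrC. Qed.
Fact dprod_add0 : left_id ((fun i => 0) : dprod)
  (fun f g : dprod => (fun i => f i + g i) : dprod).
Proof. by move=> f; apply: functional_extensionality_dep => i; rewrite add0r. Qed.
Fact dprod_addN : left_inverse ((fun i => 0) : dprod)
  (fun f : dprod => (fun i => - f i) : dprod)
  (fun f g : dprod => (fun i => f i + g i) : dprod).
Proof. by move=> f; apply: functional_extensionality_dep => i; rewrite addNr. Qed.

HB.instance Definition _ :=
  GRing.isZmodule.Build dprod dprod_addA dprod_addC dprod_add0 dprod_addN.

Let scale (a : k) (f : dprod) : dprod := fun i => a *: f i.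
Fact dprod_scaleA a b f : scale a (scale b f) = scale (a * b) f.
Proof. by apply: functional_extensionality_dep => i; rewrite /scale scalerA. Qed.
Fact dprod_scale1 : left_id 1 scale.
Proof. by move=> f; apply: functional_extensionality_dep => i; rewrite /scale scale1r. Qed.
Fact dprod_scaleDr : right_distributive scale +%R.
Proof. by move=> a f g; apply: functional_extensionality_dep => i; rewrite /scale scalerDr. Qed.
Fact dprod_scaleDl f : {morph scale^~ f : a b / a + b}.
Proof. by move=> a b; apply: functional_extensionality_dep => i; rewrite /scale scalerDl. Qed.

HB.instance Definition _ := GRing.Zmodule_isLmodule.Build k dprod
  dprod_scaleA dprod_scale1 dprod_scaleDr dprod_scaleDl.

Definition fin_supp (f : dprod) : bool :=
  `[< exists s : seq I, forall i, f i <> 0 -> List.In i s >].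

Fact fin_supp_submod_closed : submod_closed fin_supp.
Proof.
split=> [|a f g].
  by apply/asboolP; exists [::] => i; case.
move=> /asboolP[s fs] /asboolP[t gt]; apply/asboolP; exists (s ++ t) => i fgi.
apply/List.in_or_app; have [fi0|/eqP/fs] := eqVneq (f i) 0; last by left.
right; apply: gt => gi0; apply: fgi.
by rewrite /GRing.add/= /GRing.scale/= /scale fi0 gi0 scaler0 addr0.
Qed.

HB.instance Definition _ :=
  GRing.isSubmodClosed.Build k dprod fin_supp fin_supp_submod_closed.

Record dsum := DSum { dsum_val : dprod; _ : fin_supp dsum_val }.

HB.instance Definition _ := [isSub for dsum_val].
HB.instance Definition _ := [Choice of dsum by <:].
HB.instance Definition _ := [SubChoice_isSubLmodule of dsum by <:].

Definition dsum_fun (x : dsum) : forall i, V i := dsum_val x.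

End DirectSum.

Coercion dsum_fun : dsum >-> Funclass.

Section DirectSumMap.
Variables (k : fieldType) (I : Type) (V W : I -> lmodType k).
Variable f : forall i, {linear V i -> W i}.

Fact dsum_map_subproof (x : dsum V) : fin_supp (fun i => f i (x i)).
Proof.
case: x => x /= /asboolP[s xs]; apply/asboolP; exists s => i fxi.
by apply: xs => xi0; apply: fxi; rewrite xi0 linear0.
Qed.

Definition dsum_map (x : dsum V) : dsum W := DSum (dsum_map_subproof x).

Fact dsum_map_linear : linear dsum_map.
Proof.
move=> a x y; apply: val_inj; apply: functional_extensionality_dep => i /=.
exact: linearP.
Qed.

HB.instance Definition _ :=
  GRing.isLinear.Build k (dsum V) (dsum W) *:%R dsum_map dsum_map_linear.

End DirectSumMap.

Section Iterates.
Variables (k : fieldType) (V : int -> lmodType k).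
Variable d : forall i, {linear V i -> V (i + 1)}.

(* d_{i+n-1} \o ... \o d_i; its target i + n is written as n successors of i,
   so that no transport is needed. *)
Fixpoint iter_diff (n : nat) (i : int) :
    {linear V i -> V (iter n (fun j => j + 1) i)} :=
  match n return {linear V i -> V (iter n (fun j => j + 1) i)} with
  | 0%N => idfun
  | n'.+1 => d (iter n' (fun j => j + 1) i) \o iter_diff n' i
  end.

End Iterates.

Section NComplexes.
Variables (k : fieldType) (N : nat).

Record ncomplex := NComplex {
  nc_obj :> int -> lmodType k;
  nc_diff : forall i, {linear nc_obj i -> nc_obj (i + 1)};
  nc_diffN : forall i (x : nc_obj i), iter_diff nc_diff N i x = 0
}.

Record nc_hom (X Y : ncomplex) := NCHom {
  nc_map :> forall i, {linear X i -> Y i};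
  nc_mapP : forall i (x : X i),
    nc_map (i + 1) (nc_diff X i x) = nc_diff Y i (nc_map i x)
}.

Definition nc_iso (X Y : ncomplex) : Prop :=
  exists (f : nc_hom X Y) (g : nc_hom Y X),
    (forall i, cancel (f i) (g i)) /\ (forall i, cancel (g i) (f i)).

Definition nc_epi (X Y : ncomplex) (f : nc_hom X Y) : Prop :=
  forall (Z : ncomplex) (g h : nc_hom Y Z),
    (forall i x, g i (f i x) = h i (f i x)) -> forall i y, g i y = h i y.

(* Epimorphisms are those of the category of all N-complexes, of arbitrary
   dimension. *)
Definition nc_projective (P : ncomplex) : Prop :=
  forall (X Y : ncomplex) (f : nc_hom X Y) (g : nc_hom P Y), nc_epi f ->
    exists h : nc_hom P X, forall i x, f i (h i x) = g i x.

Definition nc_zero (X : ncomplex) : Prop := forall i (x : X i), x = 0.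

Section Sum.
Variables (I : Type) (F : I -> ncomplex).

Let sum_obj (j : int) : lmodType k := dsum (fun i => F i j).
Let sum_diff (j : int) : {linear sum_obj j -> sum_obj (j + 1)} :=
  dsum_map (fun i => nc_diff (F i) j).

Fact nc_sum_subproof j (x : sum_obj j) : iter_diff sum_diff N j x = 0.
Proof.
apply: val_inj; apply: functional_extensionality_dep => i /=.
have e n : dsum_fun (iter_diff sum_diff n j x) i
             = iter_diff (nc_diff (F i)) n j (x i).
  by elim: n => //= n <-.
by apply: etrans (e N) _; exact: nc_diffN.
Qed.

Definition nc_sum : ncomplex := NComplex nc_sum_subproof.
End Sum.

Definition nc_summand (P M : ncomplex) : Prop :=
  exists Q : ncomplex, nc_iso M (nc_sum (fun b : bool => if b then P else Q)).

(* The complex M_i^l.  In degree j it is the space of row vectors of length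
   (i <= j <= i + l), i.e. k inside the interval and 0 outside; pid_mx 1 is the
   1 x 1 identity matrix between two copies of k. *)
Section Interval.
Variables (i : int) (l : 'I_N).

Let int_obj (j : int) : lmodType k := 'rV[k]_(i <= j <= i + l%:Z)%R.
Let int_diff (j : int) : {linear int_obj j -> int_obj (j + 1)} :=
  mulmxr (pid_mx 1 : 'M[k]_((i <= j <= i + l%:Z)%R, (i <= j + 1 <= i + l%:Z)%R)).

Fact nc_interval_subproof j (x : int_obj j) : iter_diff int_diff N j x = 0.
Proof.
have e n : iter n (fun j => j + 1) j = j + n%:Z.
  by elim: n => [|n IH] /=; [rewrite addr0 | rewrite IH; lia].
have z m : ~~ (i <= m <= i + l%:Z) -> forall y : int_obj m, y = 0.
  have z0 n (y : 'rV[k]_n) : n = 0%N -> y = 0 by case: n y => // y _; exact: thinmx0.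
  by move=> h y; apply: z0; rewrite (negPf h).
have ltlN := ltn_ord l.
case: (boolP (i <= j <= i + l%:Z)) => [h|/z z0]; last by rewrite (z0 x) linear0.
by apply: z; rewrite e; lia.
Qed.

Definition nc_interval : ncomplex := NComplex nc_interval_subproof.
End Interval.

(* The family n is the family of multiplicities of M: M is isomorphic to the
   direct sum of n i l copies of each M_i^l. *)
Definition nc_multiplicities (M : ncomplex) (n : int -> 'I_N -> nat) : Prop :=
  nc_iso M (nc_sum (fun s : {il : int * 'I_N & 'I_(n il.1 il.2)} =>
                      nc_interval (tag s).1 (tag s).2)).

(* N-complexes of finite dimensional spaces. *)
Record fd_ncomplex := FdNComplex {
  fd_obj : int -> vectType k;
  fd_diff : forall i, {linear fd_obj i -> fd_obj (i + 1)};
  fd_diffN : forall i (x : fd_obj i), iter_diff fd_diff N i x = 0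
}.

Coercion ncomplex_of_fd (M : fd_ncomplex) : ncomplex :=
  @NComplex (fd_obj M) (fd_diff M) (@fd_diffN M).

Section AmplitudeCohomology.
Variables (M : fd_ncomplex) (a : nat) (i : int).

Fact amp_target_eq n :
  iter n (fun j => j + 1) (i - n%:Z) = i.
Proof.
have -> : forall m j, iter m (fun j => j + 1) j = j + m%:Z.
  by elim=> [|m IH] j /=; [rewrite addr0 | rewrite IH; lia].
by rewrite subrK.
Qed.

Definition fd_cast (j j' : int) (e : j = j') (x : fd_obj M j) : fd_obj M j' :=
  ecast z (fd_obj M z) e x.

Fact fd_cast_linear j j' (e : j = j') : linear (fd_cast e).
Proof. by case: j' / e. Qed.

HB.instance Definition _ j j' (e : j = j') :=
  GRing.isLinear.Build k _ _ *:%R (fd_cast e) (fd_cast_linear e).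

Definition amp_ker : {vspace fd_obj M i} :=
  lker (linfun (iter_diff (fd_diff M) a i)).

Definition amp_im : {vspace fd_obj M i} :=
  limg (linfun (fd_cast (amp_target_eq (N - a))
                \o iter_diff (fd_diff M) (N - a) (i - (N - a)%N%:Z))).

(* Used for 0 < a < N, where amp_im is contained in amp_ker.  The subspace
   factored out is amp_im seen inside the space amp_ker. *)
Definition amp_cohomology : vectType k :=
  quot_space (linfun (vsval : subvs_of amp_ker -> fd_obj M i) @^-1: amp_im)%VS.

End AmplitudeCohomology.

End NComplexes.

(* Main.v *)
(* By the decomposition into intervals, AH_a^i(M) has dimension the number of
   summands [j, e) with i + a - N < j <= i < e <= i + a (with e = j + l + 1).
   Put a = l + 1: apart from the interval starting at i of length l + 1, the
   intervals counted start before i, or start at i and are shorter.  Since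
   nothing starts below a certain degree, induction on i and then on l recovers
   the multiplicities with l < N - 1.  The remaining M_i^{N-1} are projective,
   being free on one generator of degree i (epimorphisms are surjective, by
   comparing the cokernel projection with 0), so they do not occur in M. *)
Require Import Defs.
From HB Require Import structures.
From mathcomp Require Import all_boot all_order all_algebra.
From mathcomp Require Import generic_quotient ring_quotient.
From mathcomp Require Import zify.
From mathcomp Require Import boolp.

Set Implicit Arguments.
Unset Strict Implicit.
Unset Printing Implicit Defensive.

Import Order.TTheory GRing.Theory Num.Theory.

Local Open Scope ring_scope.

(** * Cokernels of linear maps in arbitrary dimension *)

Section LinearCokernel.
Variables (k : fieldType) (U V : lmodType k) (f : {linear U -> V}).

(** Dimensions are arbitrary here, so membership in the image is made boolean by classical logic, as
    the quotient requires. *)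
Definition in_image : {pred V} := fun y => `[< exists x, f x = y >].

Fact in_image_zmod_closed : zmod_closed in_image.
Proof.
split=> [|_ _ /asboolP[x <-] /asboolP[y <-]]; apply/asboolP.
  by exists 0; rewrite linear0.
by exists (x - y); rewrite linearB.
Qed.

HB.instance Definition _ :=
  GRing.isZmodClosed.Build V in_image in_image_zmod_closed.

Definition coker : Type := Quotient.quot in_image.

HB.instance Definition _ := GRing.Zmodule.on coker.

Definition coker_proj (y : V) : coker := (\pi_(Quotient.quot in_image) y)%qT.

Lemma coker_projP y z : coker_proj y = coker_proj z <-> exists x, f x = y - z.
Proof.
rewrite /coker_proj; split=> [/eqP|yz].
  by rewrite -Quotient.idealrBE => /asboolP.
by apply/eqP; rewrite -Quotient.idealrBE; apply/asboolP.
Qed.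

Definition coker_repr (u : coker) : V := repr (u : Quotient.quot in_image).

Lemma coker_reprK : cancel coker_repr coker_proj.
Proof. by move=> u; exact: reprK. Qed.

Lemma coker_projD : {morph coker_proj : x y / x + y}.
Proof. exact: (raddfD (\pi_(Quotient.quot in_image))%qT). Qed.

Definition coker_scale (a : k) (u : coker) : coker :=
  coker_proj (a *: coker_repr u).

Lemma coker_scaleE a y : coker_scale a (coker_proj y) = coker_proj (a *: y).
Proof.
have /coker_projP[x xE] := coker_reprK (coker_proj y).
by apply/coker_projP; exists (a *: x); rewrite linearZ /= xE scalerBr.
Qed.

Fact coker_scaleA a b u : coker_scale a (coker_scale b u) = coker_scale (a * b) u.
Proof. by rewrite -[u]coker_reprK !coker_scaleE scalerA. Qed.
Fact coker_scale1 : left_id 1 coker_scale.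
Proof. by move=> u; rewrite -[u]coker_reprK coker_scaleE scale1r. Qed.
Fact coker_scaleDr : right_distributive coker_scale +%R.
Proof.
move=> a u v; rewrite -[u]coker_reprK -[v]coker_reprK.
by rewrite -coker_projD !coker_scaleE scalerDr coker_projD.
Qed.
Fact coker_scaleDl u : {morph coker_scale^~ u : a b / a + b}.
Proof.
by move=> a b; rewrite -[u]coker_reprK !coker_scaleE scalerDl coker_projD.
Qed.

HB.instance Definition _ := GRing.Zmodule_isLmodule.Build k coker
  coker_scaleA coker_scale1 coker_scaleDr coker_scaleDl.

Fact coker_proj_linear : linear coker_proj.
Proof. by move=> a x y; rewrite coker_projD -coker_scaleE. Qed.

HB.instance Definition _ :=
  GRing.isLinear.Build k V coker *:%R coker_proj coker_proj_linear.

End LinearCokernel.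

Section CokernelMap.
Variables (k : fieldType) (U V U' V' : lmodType k).
Variables (f : {linear U -> V}) (f' : {linear U' -> V'}).
Variables (u : {linear U -> U'}) (v : {linear V -> V'}).
Hypothesis square : forall x, f' (u x) = v (f x).

(** The commuting square is an argument of the map, so that the linear structure, whose proof
    depends on it, can be inferred from the term. *)
Definition coker_map of (forall x, f' (u x) = v (f x)) :=
  fun y : coker f => coker_proj f' (v (coker_repr y)).

Lemma coker_mapE y : coker_map square (coker_proj f y) = coker_proj f' (v y).
Proof.
have /coker_projP[x xE] := coker_reprK (coker_proj f y).
by apply/coker_projP; exists (u x); rewrite square xE linearB.
Qed.

Fact coker_map_linear : linear (coker_map square).
Proof.
move=> a x y; rewrite -[x]coker_reprK -[y]coker_reprK.
by rewrite -linearP !coker_mapE -linearP linearP.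
Qed.

HB.instance Definition _ :=
  GRing.isLinear.Build k (coker f) (coker f') *:%R (coker_map square) coker_map_linear.
End CokernelMap.

(** * Iterated differentials and surjectivity of epimorphisms *)

(** Stated for bare families, so that it can serve to show [N]-fold vanishing on cokernels and
    kernels not yet known to be N-complexes. *)
Lemma iter_diff_morph (k : fieldType) (V W : int -> lmodType k)
    (dV : forall i, {linear V i -> V (i + 1)})
    (dW : forall i, {linear W i -> W (i + 1)}) (f : forall i, V i -> W i) :
  (forall i x, f (i + 1) (dV i x) = dW i (f i x)) ->
  forall m i x, f _ (iter_diff dV m i x) = iter_diff dW m i (f i x).
Proof. by move=> fd; elim=> //= m IH i x; rewrite fd IH. Qed.

Lemma iter_succ m (i : int) : iter m (fun j => j + 1) i = i + m%:Z.
Proof. by elim: m => [|m IH] /=; [rewrite addr0 | rewrite IH; lia]. Qed.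

Section Epi.
Variables (k : fieldType) (N : nat).

Let Coker_obj (X Y : ncomplex k N) (f : nc_hom X Y) (i : int) : lmodType k :=
  coker (f i).
Let Coker_diff (X Y : ncomplex k N) (f : nc_hom X Y) (i : int) :
    {linear Coker_obj f i -> Coker_obj f (i + 1)} :=
  coker_map (nc_mapP f (i := i)).

Fact nc_coker_subproof (X Y : ncomplex k N) (f : nc_hom X Y) i (z : Coker_obj f i) :
  iter_diff (Coker_diff f) N i z = 0.
Proof.
rewrite -[z]coker_reprK.
rewrite -(iter_diff_morph (dV := nc_diff Y) (f := fun i => coker_proj (f i))).
  by rewrite nc_diffN linear0.
by move=> j y; rewrite /Coker_diff /= coker_mapE.
Qed.

Definition nc_coker (X Y : ncomplex k N) (f : nc_hom X Y) : ncomplex k N :=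
  NComplex (@nc_coker_subproof X Y f).

Lemma nc_epi_surj (X Y : ncomplex k N) (f : nc_hom X Y) :
  nc_epi f -> forall i y, exists x, f i x = y.
Proof.
move=> epi_f i y.
have pP j (z : Y j) : coker_proj (f (j + 1)) (nc_diff Y j z)
    = nc_diff (nc_coker f) j (coker_proj (f j) z).
  by rewrite /= /Coker_diff /= coker_mapE.
have zP j (z : Y j) : (\0 : {linear _ -> _}) (nc_diff Y j z)
    = nc_diff (nc_coker f) j ((\0 : {linear _ -> _}) z).
  by rewrite /= linear0.
pose p : nc_hom Y (nc_coker f) :=
  @NCHom k N Y (nc_coker f) (fun j => coker_proj (f j)) pP.
pose z : nc_hom Y (nc_coker f) :=
  @NCHom k N Y (nc_coker f) (fun j => \0) zP.
have /epi_f/(_ i y)/= pz : forall j x, p j (f j x) = z j (f j x).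
  move=> j x /=; rewrite -[RHS](linear0 (coker_proj (f j))).
  by apply/coker_projP; exists x; rewrite subr0.
have /coker_projP[x xE] : coker_proj (f i) y = coker_proj (f i) 0.
  by rewrite pz linear0.
by exists x; rewrite xE subr0.
Qed.

End Epi.

(** * Coordinates along the interval summands *)

Definition active (i : int) (l : nat) (j : int) : bool := i <= j <= i + l%:Z.

(* The sum of the entries is the coordinate of a row vector of length 0 or 1,
   given by the same formula in both cases. *)
Section RowSum.
Variables (k : fieldType) (n : nat).

Definition row_sum (v : 'rV[k]_n) : k^o := \sum_t v 0 t.

Fact row_sum_linear : linear row_sum.
Proof.
move=> a u v; rewrite /row_sum scaler_sumr -big_split /=.
by apply: eq_bigr => t _; rewrite !mxE.
Qed.

HB.instance Definition _ :=
  GRing.isLinear.Build k 'rV[k]_n k^o *:%R row_sum row_sum_linear.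

End RowSum.

Lemma row_sum_const (k : fieldType) (b : bool) (c : k) :
  row_sum (const_mx c : 'rV[k]_b) = b%:R * c.
Proof.
rewrite /row_sum; case: b; first by rewrite big_ord1 mxE mul1r.
by rewrite big_ord0 mul0r.
Qed.

Lemma const_row_sum (k : fieldType) (b : bool) (v : 'rV[k]_b) :
  const_mx (row_sum v) = v.
Proof.
apply/rowP; case: b v => v t; last by case: t.
by rewrite mxE /row_sum big_ord1 !ord1.
Qed.

Lemma row_sum_inactive (k : fieldType) (b : bool) (v : 'rV[k]_b) :
  ~~ b -> row_sum v = 0.
Proof. by case: b v => // v _; rewrite /row_sum big_ord0. Qed.

Lemma row_sum_pid (k : fieldType) (b b' : bool) (v : 'rV[k]_b) :
  row_sum (v *m (pid_mx 1 : 'M_(b, b'))) = b'%:R * row_sum v.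
Proof.
rewrite /row_sum; case: b' => /=; last by rewrite big_ord0 mul0r.
rewrite big_ord1 mxE mul1r; apply: eq_bigr => t _; rewrite mxE /=.
by case: b v t => v [[|[]] //= ?]; rewrite mulr1.
Qed.

Section Coordinates.
Variables (k : fieldType) (N : nat).
Implicit Types (n : int -> 'I_N -> nat).

Definition copies n := {il : int * 'I_N & 'I_(n il.1 il.2)}.

Definition sactive n (s : copies n) (j : int) : bool :=
  active (tag s).1 (tag s).2 j.

(* The coordinates with respect to the standard generators of the interval
   summands; a summand that vanishes in degree j has coordinate 0 there. *)
Definition coordinates n (M : ncomplex k N)
    (chi : copies n -> forall j, {linear M j -> k^o}) : Prop :=
  [/\ forall j x, (forall s, chi s j x = 0) -> x = 0,
      forall j s x, ~~ sactive s j -> chi s j x = 0,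
      forall j s x, chi s (j + 1) (nc_diff M j x)
                      = (sactive s (j + 1))%:R * chi s j x &
      forall j (c : copies n -> k), (forall s, ~~ sactive s j -> c s = 0) ->
        exists x, forall s, chi s j x = c s].

(** An interval containing [j] has length at most [N], hence starts at [j - t] with [t < N];
    finitely many pairs [(t, l)] remain, each with finitely many copies. This gives the finite
    support of a vector built from its coordinates. *)
Lemma active_finite n j :
  exists r : seq (copies n), forall s, sactive s j -> List.In s r.
Proof.
pose T : finType := {p : 'I_N * 'I_N & 'I_(n (j - (p.1 : nat)%:Z) p.2)}.
pose f (z : T) : copies n :=
  @Tagged _ (j - ((tag z).1 : nat)%:Z, (tag z).2) (fun il => 'I_(n il.1 il.2)) (tagged z).
exists [seq f z | z : T] => -[[i l] q] /=.
rewrite /sactive /active /= => ij.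
have tN : (`|j - i| < N)%N by have := ltn_ord l; lia.
have iE : i = j - ((Ordinal tN : 'I_N) : nat)%:Z by rewrite /=; lia.
move: q; rewrite iE => q.
pose z : T := @Tagged _ (Ordinal tN, l) (fun p => 'I_(n (j - (p.1 : nat)%:Z) p.2)) q.
have -> : existT (fun il : int * 'I_N => 'I_(n il.1 il.2))
  (j - (Ordinal tN : nat)%:Z, l) q = f z by [].
apply: List.in_map; have : z \in enum T by rewrite mem_enum.
elim: (enum T) => //= y r IH; rewrite inE => /orP[/eqP->|/IH]; first by left.
by right.
Qed.

(** Compose the isomorphism onto the direct sum, the projection to a summand and [row_sum]. *)
Lemma coordinates_exist n (M : ncomplex k N) :
  nc_multiplicities M n -> exists chi, @coordinates n M chi.
Proof.
case=> f [g [fK gK]].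
pose F (s : copies n) := nc_interval k (tag s).1 (tag s).2.
have actE (s : copies n) j (v : F s j) : ~~ sactive s j -> row_sum v = 0.
  exact: row_sum_inactive.
have lin s j : linear (fun x => row_sum (f j x s) : k^o).
  by move=> a x y; rewrite linearP; exact: linearP.
pose chi s j : {linear M j -> k^o} :=
  HB.pack (fun x => row_sum (f j x s) : k^o)
    (GRing.isLinear.Build k (M j) k^o *:%R _ (lin s j)).
exists chi; split.
- move=> j x x0; apply: (can_inj (fK j)); rewrite linear0.
  apply: val_inj; apply: functional_extensionality_dep => s /=.
  have /= e := x0 s.
  by rewrite -[LHS]const_row_sum [row_sum _]e; apply/rowP => t; rewrite !mxE.
- by move=> j s x /actE/=->.
- by move=> j s x /=; rewrite nc_mapP /= [LHS]row_sum_pid.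
move=> j c c0.
have fin : fin_supp (fun s => const_mx (c s) : F s j).
  have [r rP] := active_finite n j; apply/asboolP; exists r => s s0.
  apply: rP; apply/negP => /negP /c0 cs; apply: s0.
  by rewrite cs; apply/rowP => t; rewrite !mxE.
exists (g j (DSum fin)) => s /=; rewrite gK /= [LHS]row_sum_const.
have := c0 s; rewrite /sactive /active.
by case: (_ <= _ <= _) => [_|->]; rewrite ?mul1r ?mulr0.
Qed.

End Coordinates.

(** * The dimension of amplitude cohomology in terms of multiplicities *)

Lemma dim_ffun_regular (k : fieldType) (J : finType) :
  \dim {: {ffun J -> k^o}} = #|J|.
Proof. by rewrite dimvf /dim /= muln1. Qed.

(** Intervals are convex: a summand active in degrees [j] and [j + m] is active in between, so the
    product of the factors of the single steps collapses to the last one. *)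
Lemma coordinates_iter_diff (k : fieldType) (N : nat) (n : int -> 'I_N -> nat)
    (M : ncomplex k N) chi : @coordinates k N n M chi ->
  forall m s j x, chi s _ (iter_diff (nc_diff M) m j x)
    = (sactive s (j + m%:Z))%:R * chi s j x.
Proof.
case=> _ chi0 chid _ m s j x; elim: m => [|m IH] /=.
  rewrite addr0; case: (boolP (sactive s j)) => [_|/chi0->]; first by rewrite mul1r.
  by rewrite mul0r.
rewrite chid IH iter_succ.
have -> : j + m%:Z + 1 = j + m.+1%:Z by lia.
rewrite mulrA -natrM mulnb.
case: (boolP (sactive s j)) => [sj|/chi0->]; last by rewrite !mulr0.
by congr (_%:R * _); congr nat_of_bool; move: sj; rewrite /sactive /active; lia.
Qed.

(* The summand M_{i-t}^l has nonzero AH_a^i. *)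
Definition amp_cond (N a : nat) (t l : 'I_N) : bool :=
  (t <= l < a + t)%N && (t < N - a)%N.

(** The pair [p = (t, l)] stands for the intervals of length [l + 1] starting [t] degrees before
    [i]; those starting [N] or more degrees before do not reach [i]. *)
Definition amp_count (N : nat) (n : int -> 'I_N -> nat) (a : nat) (i : int) : nat :=
  (\sum_(p : 'I_N * 'I_N) if amp_cond a p.1 p.2 then n (i - (p.1 : nat)%:Z)%R p.2 else 0%N)%N.

Section AmplitudeDimension.
Variables (k : fieldType) (N : nat) (n : int -> 'I_N -> nat).
Variables (M : fd_ncomplex k N).
Variable chi : copies n -> forall j, {linear fd_obj M j -> k^o}.
Hypothesis chiP : @coordinates k N n M chi.
Variables (a : nat) (i : int).
Hypothesis aN : (1 <= a <= N - 1)%N.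

(** The fibres off [amp_cond] are empty, so that the cardinality is the sum [amp_count]. *)
Let J : finType :=
  {p : 'I_N * 'I_N & 'I_(if amp_cond a p.1 p.2 then n (i - (p.1 : nat)%:Z)%R p.2 else 0%N)}.

Let ord_if (b : bool) m (q : 'I_(if b then m else 0)) : 'I_m :=
  widen_ord (if b as b0 return ((if b0 then m else 0) <= m)%N then leqnn m else leq0n m) q.

Let incl (z : J) : copies n :=
  @Tagged _ (i - ((tag z).1 : nat)%:Z, (tag z).2) (fun il => 'I_(n il.1 il.2))
    (ord_if (tagged z)).

(** The generator in degree [i] of such a summand is killed by [d^a] and is not hit by [d^(N-a)], so
    it contributes one dimension to the cohomology. *)
Let carries (s : copies n) : bool :=
  [&& sactive s i, ~~ sactive s (i + a%:Z) & ~~ sactive s (i - (N - a)%N%:Z)].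

Lemma card_amp_index : #|J| = amp_count n a i.
Proof.
rewrite card_tagged sumnE big_map big_enum /=.
by apply: eq_bigr => p _; rewrite card_ord.
Qed.

Lemma incl_inj : injective incl.
Proof.
case=> -[t l] q [[t' l'] q'] /= e.
have et : t' = t.
  apply: val_inj; have /= := congr1 (fun s : copies n => (tag s).1) e; lia.
have el : l' = l by have /= := congr1 (fun s : copies n => (tag s).2) e.
case: t' / {et} (esym et) q' e => q' e; case: l' / {el} (esym el) q' e => q' e.
congr existT; apply: val_inj => /=.
have := congr1 (fun s : copies n => nat_of_ord (tagged s)) e.
by [].
Qed.

Lemma incl_carries z : carries (incl z).
Proof.
case: z => -[t l] q; rewrite /carries /sactive /active /=.
(* [q] lies in the fibre over [(t, l)], which is empty unless [amp_cond] holds. *)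
have : amp_cond a t l by case: q => /= m; case: ifP.
by have := ltn_ord l; rewrite /amp_cond; lia.
Qed.

Lemma carries_incl s : carries s -> exists z, s = incl z.
Proof.
case: s => -[j l] q; rewrite /carries /sactive /active /= => h.
have tN : (`|i - j| < N)%N by have := ltn_ord l; lia.
pose t : 'I_N := Ordinal tN.
have jE : j = i - (t : nat)%:Z by rewrite /=; lia.
move: q h; rewrite jE => q h.
have tl : amp_cond a t l by move: h; rewrite /amp_cond /=; lia.
have qlt : (q < if amp_cond a t l then n (i - (t : nat)%:Z)%R l else 0%N)%N.
  by rewrite tl.
exists (@Tagged _ (t, l) (fun p : 'I_N * 'I_N =>
  'I_(if amp_cond a p.1 p.2 then n (i - (p.1 : nat)%:Z)%R p.2 else 0%N)) (Ordinal qlt)).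
by congr existT; apply: val_inj.
Qed.

Let coord_vec (x : fd_obj M i) : {ffun J -> k^o} := [ffun z => chi (incl z) i x].

Fact coord_vec_linear : linear coord_vec.
Proof. by move=> b x y; apply/ffunP => z; rewrite !ffunE linearP. Qed.

HB.instance Definition _ :=
  GRing.isLinear.Build k _ _ *:%R coord_vec coord_vec_linear.

Lemma coord_vec_eq0 x :
  (coord_vec x == 0) = `[< forall s, carries s -> chi s i x = 0 >].
Proof.
apply/eqP/asboolP => [x0 s /carries_incl[z ->]|x0].
  by have /ffunP/(_ z) := x0; rewrite !ffunE.
by apply/ffunP => z; rewrite !ffunE x0 // incl_carries.
Qed.

(** On coordinates, [d^a] is multiplication by 1 or 0 according as the summand is active in degree
    [i + a], and coordinates separate vectors. *)
Lemma mem_amp_ker x :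
  x \in amp_ker M a i <-> forall s, sactive s (i + a%:Z) -> chi s i x = 0.
Proof.
rewrite memv_ker lfunE /=; have it := coordinates_iter_diff chiP a.
case: chiP => chi_inj chi0 _ _; split=> [/eqP x0 s sa|x0].
  by have := it s i x; rewrite [iter_diff _ _ _ _]x0 linear0 sa mul1r.
apply/eqP; apply: chi_inj => s; rewrite [LHS]it.
by case: (boolP (sactive s _)) => [/x0->|_]; rewrite ?mulr0 ?mul0r.
Qed.

Lemma chi_cast s j j' (e : j = j') x : chi s j' (fd_cast e x) = chi s j x.
Proof. by case: j' / e. Qed.

Lemma mem_amp_im x : x \in amp_im M a i <->
  forall s, sactive s i -> ~~ sactive s (i - (N - a)%N%:Z) -> chi s i x = 0.
Proof.
have it := coordinates_iter_diff chiP (N - a).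
case: chiP => chi_inj chi0 _ chi_surj; split.
  move=> /memv_imgP[y _ ->] s si sNa; rewrite lfunE /= chi_cast [LHS]it.
  by rewrite (chi0 _ _ y) // mulr0.
move=> x0.
(* A preimage is built in degree [j] with the coordinates of [x] on the summands active there; on
   those active in [i] but not in [j], [x] has coordinate 0 by assumption. *)
pose j := i - (N - a)%N%:Z.
have c0 s : ~~ sactive s j -> (sactive s j)%:R * chi s i x = 0.
  by move=> /negPf->; rewrite mul0r.
have [y yE] := chi_surj j _ c0.
apply/memv_imgP; exists y; first exact: memvf.
rewrite lfunE /=; apply/eqP; rewrite -subr_eq0; apply/eqP/chi_inj => s.
rewrite linearB /= chi_cast; apply/eqP; rewrite subr_eq0; apply/eqP.
rewrite it yE subrK.
case: (boolP (sactive s i)) => [si|/chi0->]; last by rewrite mul0r.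
case: (boolP (sactive s j)) => [sj|sj]; first by rewrite !mul1r.
by rewrite mul0r mulr0 x0.
Qed.

(** Rank-nullity for the map from the kernel of [d^a] to the coordinates on the carrying summands:
    it is onto, and its kernel is the image of [d^(N-a)]. *)
Lemma dim_amp_cohomology : \dim {: amp_cohomology M a i} = amp_count n a i.
Proof.
rewrite -card_amp_index -(dim_ffun_regular k) dim_quot_space.
pose c := linfun (coord_vec \o vsval : subvs_of (amp_ker M a i) -> _).
have cE u : c u = coord_vec (vsval u) by rewrite lfunE.
have kerc : lker c = (linfun (vsval : subvs_of (amp_ker M a i) -> fd_obj M i)
                        @^-1: amp_im M a i)%VS.
  apply/vspaceP => u; rewrite memv_ker cE coord_vec_eq0 -memv_preim lfunE /=.
  apply/asboolP/idP => [u0|/mem_amp_im u0 s /and3P[si _ sNa]]; last exact: u0.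
  apply/mem_amp_im => s si sNa.
  case: (boolP (sactive s (i + a%:Z))) => sa; last by rewrite u0 // /carries si sa.
  by have /mem_amp_ker/(_ s sa) := subvsP u.
have imc : limg c = fullv.
  apply/eqP; rewrite eqEsubv subvf /=; apply/subvP => r _.
  case: chiP => chi_inj chi0 _ chi_surj.
  (* Extension of [r] by zero along the injection [incl]: the sum has at most one term. *)
  pose b (s : copies n) := \sum_(z | incl z == s) r z.
  have b0 s : ~~ carries s -> b s = 0.
    by move=> ns; apply: big1 => z /eqP zs; rewrite -zs incl_carries in ns.
  have bi0 s : ~~ sactive s i -> b s = 0.
    by move=> /negPf si; rewrite b0 // /carries si.
  have [x xE] := chi_surj i b bi0.
  have xker : x \in amp_ker M a i.
    by apply/mem_amp_ker => s sa; rewrite xE b0 // /carries sa andbF.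
  apply/memv_imgP; exists (vsproj _ x); first exact: memvf.
  rewrite cE vsprojK //; apply/ffunP => z; rewrite ffunE xE /b.
  by rewrite (big_pred1 z) // => z'; rewrite (inj_eq incl_inj).
by rewrite -(limg_ker_dim c fullv) capfv kerc addKn imc.
Qed.

End AmplitudeDimension.

(** * Morphisms out of intervals and projectivity of the longest ones *)

(* The orbit x, d x, d (d x), ... as a family over all degrees, which is 0 below
   the degree i of x. *)
Section Orbit.
Variables (k : fieldType) (V : int -> lmodType k).
Variables (d : forall i, {linear V i -> V (i + 1)}) (i : int) (x : V i).

Definition orbit_at (j : int) : V j :=
  match @eqP _ (iter `|(j - i)%R| (fun j => j + 1) i) j with
  | ReflectT e => ecast z (V z) e (iter_diff d `|(j - i)%R| i x)
  | ReflectF _ => 0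
  end.

Lemma orbit_at_iter m : orbit_at (iter m (fun j => j + 1) i) = iter_diff d m i x.
Proof.
rewrite /orbit_at; case: eqP => [e|]; last first.
  by case; rewrite !iter_succ; lia.
have mE : `|(iter m (fun j => j + 1) i - i)%R|%N = m by rewrite iter_succ; lia.
(* The transport now goes from a degree to itself, hence is trivial by uniqueness of identity
   proofs. *)
move: e; rewrite mE => e; by rewrite eq_axiomK.
Qed.

Lemma orbit_at0 : orbit_at i = x.
Proof. exact: (orbit_at_iter 0). Qed.

(** The bound on [j] matters: from [i - 1] to [i] the family jumps from 0 to [x]. *)
Lemma orbit_atS j : i <= j -> orbit_at (j + 1) = d j (orbit_at j).
Proof.
move=> ij; have [m ->] : exists m, j = iter m (fun j => j + 1) i.
  by exists `|(j - i)%R|%N; rewrite iter_succ; lia.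
by rewrite orbit_at_iter [LHS](orbit_at_iter m.+1).
Qed.

Lemma orbit_at_eq0 m j : (forall y, iter_diff d m i y = 0) -> j = i + m%:Z ->
  orbit_at j = 0.
Proof. by move=> d0 ->; rewrite -iter_succ orbit_at_iter d0. Qed.

End Orbit.

Section IntervalMaps.
Variables (k : fieldType) (N : nat) (i : int) (l : 'I_N).
Local Notation P := (nc_interval k i l).

Lemma row_sum_interval j (v : P j) : ~~ active i l j -> row_sum v = 0.
Proof. exact: row_sum_inactive. Qed.

Lemma row_sum_diff j (v : P j) :
  row_sum (nc_diff P j v) = (active i l (j + 1))%:R * row_sum v.
Proof. exact: row_sum_pid. Qed.

Lemma row_sum_interval_const j c :
  row_sum (const_mx c : P j) = (active i l j)%:R * c.
Proof. exact: row_sum_const. Qed.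

Lemma interval_eq j (v w : P j) : row_sum v = row_sum w -> v = w.
Proof.
by move=> e; rewrite -[LHS]const_row_sum -[RHS]const_row_sum; congr const_mx.
Qed.

(** The vector [b j] is the image of the generator of degree [j]. Outside the interval [row_sum v]
    is 0, so [b] may take any values there. *)
Lemma interval_hom (X : ncomplex k N) (b : forall j, X j) :
  (forall j, active i l j ->
     nc_diff X j (b j) = (active i l (j + 1))%:R *: b (j + 1)) ->
  exists h : nc_hom P X, forall j v, h j v = row_sum v *: b j.
Proof.
move=> bd.
have lin j : linear (fun v : P j => row_sum v *: b j).
  by move=> c u v; rewrite linearP scalerDl scalerA.
pose h j : {linear P j -> X j} :=
  HB.pack (fun v : P j => row_sum v *: b j)
    (GRing.isLinear.Build k (P j) (X j) *:%R _ (lin j)).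
have hd j v : h (j + 1) (nc_diff P j v) = nc_diff X j (h j v).
  rewrite /= linearZZ [X in X *: _]row_sum_diff.
  case: (boolP (active i l j)) => [/bd->|/row_sum_interval->].
    by rewrite scalerA [X in _ = X *: _]mulrC.
  by rewrite [X in X *: _]mulr0 !scale0r.
by exists (NCHom hd).
Qed.

(** Lift the generator of degree [i] and follow the orbit of the lift: the only relation on the
    generator is that [N] differentials kill it, and this holds in [X]. *)
Lemma interval_projective : l.+1 = N -> nc_projective P.
Proof.
move=> lN X Y f g /nc_epi_surj surj_f.
have ii : active i l i by rewrite /active; lia.
have [x xE] := surj_f i (g i (const_mx 1)).
pose b j := orbit_at (nc_diff X) x j.
have bd j : active i l j ->
    nc_diff X j (b j) = (active i l (j + 1))%:R *: b (j + 1).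
  move=> ij; rewrite -orbit_atS; last by move: ij; rewrite /active; lia.
  case: (boolP (active i l (j + 1))) => nij; first by rewrite scale1r.
  (* Here [j] is the last degree [i + N - 1]. *)
  rewrite scale0r; apply: (@orbit_at_eq0 _ _ _ _ _ N).
    exact: nc_diffN.
  by move: ij nij; rewrite /active; lia.
have [h hE] := interval_hom bd; exists h.
have fb m : (m <= l)%N ->
    f (i + m%:Z) (b (i + m%:Z)) = g (i + m%:Z) (const_mx 1).
  elim: m => [|m IH] ml; first by rewrite addr0 /b orbit_at0 xE.
  have -> : i + m.+1%:Z = i + m%:Z + 1 by lia.
  rewrite /b orbit_atS; last by lia.
  rewrite nc_mapP IH; last exact: ltnW.
  rewrite -nc_mapP; congr (g _ _); apply: interval_eq.
  rewrite row_sum_diff !row_sum_interval_const.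
  have am : active i l (i + m%:Z) by rewrite /active; lia.
  have am1 : active i l (i + m%:Z + 1) by rewrite /active; lia.
  by rewrite am am1 !mul1r.
move=> j v; rewrite hE linearZ /=.
(* A vector is its coordinate times the generator in active degrees, and 0 in the others. *)
case: (boolP (active i l j)) => [ij|nij]; last first.
  rewrite row_sum_interval // scale0r.
  suff -> : v = 0 by rewrite linear0.
  by apply: interval_eq; rewrite row_sum_interval // linear0.
have jE : j = i + `|(j - i)%R|%:Z by move: ij; rewrite /active; lia.
have jl : (`|(j - i)%R| <= l)%N by move: ij; rewrite /active; lia.
have ij' : active i l (i + `|(j - i)%R|%:Z) by rewrite -jE.
move: v; rewrite jE => v; rewrite fb // -linearZ; congr (g _ _).
apply: interval_eq; rewrite linearZZ [X in _ *: X]row_sum_interval_const ij' mul1r.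
exact: mulr1.
Qed.

End IntervalMaps.

(** * Splitting off one interval summand *)

(** The identities of a biproduct, with which a splitting is given by four morphisms, without
    handling elements of the sum over [bool]. *)
Lemma biproduct_summand (k : fieldType) (N : nat) (M P Q : ncomplex k N)
    (p : nc_hom M P) (inP : nc_hom P M) (q : nc_hom M Q) (inQ : nc_hom Q M) :
  (forall j v, p j (inP j v) = v) -> (forall j w, q j (inQ j w) = w) ->
  (forall j w, p j (inQ j w) = 0) -> (forall j v, q j (inP j v) = 0) ->
  (forall j x, inP j (p j x) + inQ j (q j x) = x) ->
  nc_summand P M.
Proof.
move=> pP qQ pQ qP pq; exists Q.
pose F (b : bool) := if b then P else Q.
pose to j (x : M j) : dprod (fun b => F b j) :=
  fun b => if b as b0 return F b0 j then p j x else q j x.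
have fin j x : fin_supp (to j x).
  by apply/asboolP; exists [:: true; false] => -[] _; [left | right; left].
have to_lin j : linear (fun x => DSum (fin j x)).
  move=> a x y; apply: val_inj; apply: functional_extensionality_dep.
  by case; exact: linearP.
pose f j : {linear M j -> nc_sum F j} :=
  HB.pack (fun x => DSum (fin j x) : nc_sum F j)
    (GRing.isLinear.Build k (M j) (nc_sum F j) *:%R _ (to_lin j)).
have fd j x : f (j + 1) (nc_diff M j x) = nc_diff (nc_sum F) j (f j x).
  apply: val_inj; apply: functional_extensionality_dep.
  by case; exact: nc_mapP.
have of_lin j : linear (fun z : nc_sum F j => inP j (z true) + inQ j (z false)).
  by move=> a x y; rewrite !linearP scalerDr addrACA.
pose g j : {linear nc_sum F j -> M j} :=
  HB.pack (fun z : nc_sum F j => inP j (z true) + inQ j (z false))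
    (GRing.isLinear.Build k (nc_sum F j) (M j) *:%R _ (of_lin j)).
have gd j z : g (j + 1) (nc_diff (nc_sum F) j z) = nc_diff M j (g j z).
  by rewrite /= linearD -!nc_mapP.
exists (NCHom fd), (NCHom gd); split=> j x /=; first exact: pq.
apply: val_inj; apply: functional_extensionality_dep => -[] /=.
  by rewrite linearD pP pQ addr0.
by rewrite linearD qQ qP add0r.
Qed.

Section SplitInterval.
Variables (k : fieldType) (N : nat) (n : int -> 'I_N -> nat).
Variables (M : fd_ncomplex k N).
Variable chi : copies n -> forall j, {linear fd_obj M j -> k^o}.
Hypothesis chiP : @coordinates k N n M chi.
Variable s0 : copies n.

Let K j : {vspace fd_obj M j} := lker (linfun (chi s0 j)).

Lemma mem_chi_ker j x : (x \in K j) = (chi s0 j x == 0).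
Proof. by rewrite memv_ker lfunE. Qed.

Let ker_diff (j : int) : {linear subvs_of (K j) -> subvs_of (K (j + 1))} :=
  vsproj (K (j + 1)) \o fd_diff M j \o vsval.

(** The [s0] coordinate of [d x] is a multiple of that of [x], so the differential preserves the
    kernels and [vsproj] changes nothing. *)
Lemma vsval_ker_diff j u : vsval (ker_diff j u) = fd_diff M j (vsval u).
Proof.
rewrite /= vsprojK // mem_chi_ker; case: chiP => _ _ chid _.
by rewrite [chi _ _ _]chid; have := subvsP u; rewrite mem_chi_ker => /eqP->; rewrite mulr0.
Qed.

Fact ker_diffN j u : iter_diff ker_diff N j u = 0.
Proof.
apply: val_inj; rewrite linear0.
apply: etrans (iter_diff_morph (dW := fd_diff M) vsval_ker_diff N u) _.
exact: fd_diffN.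
Qed.

Definition chi_ker : ncomplex k N := NComplex ker_diffN.

(** Each vector is its [s0] coordinate times a generator plus a vector of [chi_ker], compatibly with
    the differentials. *)
Lemma interval_summand : nc_summand (nc_interval k (tag s0).1 (tag s0).2) M.
Proof.
set P := nc_interval _ _ _.
have [chi_inj chi0 chid chi_surj] := chiP.
(* [b j] is the generator of the copy [s0] in degree [j], and 0 where this copy is not active. *)
have /(_ _)/cid bP j : exists b, forall s, chi s j b = ((s == s0) && sactive s j)%:R.
  by apply: chi_surj => s /negPf->; rewrite andbF.
pose b j : M j := sval (bP j).
have bE j s : chi s j (b j) = ((s == s0) && sactive s j)%:R by exact: svalP (bP j) s.
have bd j : sactive s0 j ->
    nc_diff M j (b j) = (sactive s0 (j + 1))%:R *: b (j + 1).
  move=> ij; apply/eqP; rewrite -subr_eq0; apply/eqP/chi_inj => s.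
  rewrite linearB linearZZ chid !bE.
  have [->|_] := eqVneq s s0; last by rewrite /= mulr0 scaler0 subrr.
  rewrite ij mulr1 /=; apply/eqP; rewrite subr_eq0; apply/eqP.
  by case: sactive => /=; rewrite ?scale1r ?scale0r.
have [inP inPE] := interval_hom bd.
have plin j : linear (fun x : M j => const_mx (chi s0 j x) : P j).
  by move=> c x y; apply/rowP => t; rewrite !mxE linearP.
pose p j : {linear M j -> P j} :=
  HB.pack (fun x : M j => const_mx (chi s0 j x) : P j)
    (GRing.isLinear.Build k (M j) (P j) *:%R _ (plin j)).
have pd j x : p (j + 1) (nc_diff M j x) = nc_diff P j (p j x).
  apply: interval_eq; rewrite row_sum_diff /= !row_sum_interval_const chid.
  case: (boolP (sactive s0 j)) => [ij|/chi0->]; last by rewrite !mulr0.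
  rewrite [active _ _ j]ij mul1r mulrA -natrM mulnb.
  by rewrite -[active _ _ (j + 1)]/(sactive s0 (j + 1)) andbb.
pose r j (x : M j) : M j := x - chi s0 j x *: b j.
(* The coordinate of [b j] is 1 where [s0] is active; elsewhere both sides are 0. *)
have chib j x : chi s0 j x * chi s0 j (b j) = chi s0 j x.
  rewrite bE eqxx /=; case: (boolP (sactive s0 j)) => [_|/chi0->]; first exact: mulr1.
  exact: mul0r.
have rK j x : r j x \in K j.
  by rewrite mem_chi_ker linearB linearZZ [X in _ - X]chib subrr.
have qlin j : linear (fun x : M j => vsproj (K j) (r j x)).
  move=> c x y; rewrite -linearP; congr vsproj.
  by rewrite /r linearP scalerDl scalerBr scalerA opprD addrACA.
pose q j : {linear M j -> chi_ker j} :=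
  HB.pack (fun x : M j => vsproj (K j) (r j x) : chi_ker j)
    (GRing.isLinear.Build k (M j) (chi_ker j) *:%R _ (qlin j)).
have qd j x : q (j + 1) (nc_diff M j x) = nc_diff chi_ker j (q j x).
  apply: val_inj; rewrite [RHS]vsval_ker_diff /= !vsprojK; [rewrite /r|exact: rK..].
  rewrite [RHS]linearB [in RHS]linearZZ; congr (_ - _); rewrite [chi _ _ _]chid.
  case: (boolP (sactive s0 j)) => [/bd e|/chi0->]; last by rewrite mulr0 !scale0r.
  by rewrite [fd_diff _ _ _]e scalerA mulrC.
have inQd j (u : chi_ker j) : vsval (nc_diff chi_ker j u) = nc_diff M j (vsval u).
  exact: vsval_ker_diff.
pose inQ : nc_hom chi_ker M := @NCHom k N chi_ker M (fun j => vsval) inQd.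
have pinP j v : p j (inP j v) = v.
  apply: interval_eq; rewrite inPE /= row_sum_interval_const linearZZ bE eqxx /=.
  rewrite -[active _ _ _]/(sactive s0 j).
  case: (boolP (sactive s0 j)) => [_|h]; first by rewrite mul1r [LHS]mulr1.
  by rewrite mul0r row_sum_interval.
have chik j (u : chi_ker j) : chi s0 j (vsval u) = 0.
  by apply/eqP; rewrite -mem_chi_ker; exact: subvsP.
apply: (@biproduct_summand _ _ _ _ _ (NCHom pd) inP (NCHom qd) inQ) => //=.
- by move=> j w; rewrite /r chik scale0r subr0 vsvalK.
- by move=> j w; rewrite chik; apply/rowP => t; rewrite !mxE.
- move=> j v; rewrite inPE -[RHS](linear0 (vsproj (K j))); congr vsproj.
  rewrite /r [chi _ _ _]linearZZ bE eqxx /= -/(sactive s0 j).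
  case: (boolP (sactive s0 j)) => [_|h]; first by rewrite [X in _ - X *: _]mulr1 subrr.
  by rewrite (@row_sum_interval _ _ _ _ j v h) !scale0r subrr.
move=> j x; rewrite inPE vsprojK; last exact: rK.
rewrite [X in X *: _](@row_sum_interval_const _ _ (tag s0).1 (tag s0).2).
rewrite -/(sactive s0 j) /r addrC; case: (boolP (sactive s0 j)) => [_|/chi0->].
  by rewrite mul1r subrK.
by rewrite mulr0 subrK.
Qed.

End SplitInterval.

(** * Recovering the multiplicities *)

Lemma multiplicity_below (k : fieldType) (N : nat) (M : fd_ncomplex k N) n
    (i : int) (l : 'I_N) :
  nc_multiplicities M n -> (forall x : M i, x = 0) -> n i l = 0%N.
Proof.
move=> /coordinates_exist[chi [_ _ _ chi_surj]] M0.
case: (posnP (n i l)) => // nil.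
pose s : copies n := @Tagged _ (i, l) (fun il => 'I_(n il.1 il.2)) (Ordinal nil).
(* The test vector has all active coordinates equal to 1; it is nonzero, since the copy [s] is
   active in its first degree [i]. *)
have [s' |x] := chi_surj i (fun s => (sactive s i)%:R).
  by move=> /negPf->.
move=> /(_ s); rewrite (M0 x) linear0 /sactive /active /=.
have -> : i <= i <= i + l%:Z by lia.
by move/esym/eqP; rewrite oner_eq0.
Qed.

Lemma multiplicity_top (k : fieldType) (N : nat) (M : fd_ncomplex k N) n
    (i : int) (l : 'I_N) :
  (forall P : ncomplex k N, nc_projective P -> nc_summand P M -> nc_zero P) ->
  nc_multiplicities M n -> l.+1 = N -> n i l = 0%N.
Proof.
move=> noproj /coordinates_exist[chi chiP] lN.
case: (posnP (n i l)) => // nil.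
pose s : copies n := @Tagged _ (i, l) (fun il => 'I_(n il.1 il.2)) (Ordinal nil).
have /(_ i (const_mx 1)) := noproj _ (@interval_projective k N i l lN)
  (interval_summand chiP s).
move=> /(congr1 (@row_sum k _)); rewrite row_sum_interval_const linear0.
have -> : active i l i by rewrite /active; lia.
by rewrite mulr1 => /eqP; rewrite oner_eq0.
Qed.

Lemma amp_count_inj (N : nat) (n n' : int -> 'I_N -> nat) (b : int) :
  (forall i l, i <= b -> n i l = n' i l) ->
  (forall a i, (1 <= a <= N - 1)%N -> amp_count n a i = amp_count n' a i) ->
  forall i (l : 'I_N), (l.+1 < N)%N -> n i l = n' i l.
Proof.
move=> nb eq_amp i l lN.
(* Induction on the distance from [b], up to which the families agree; inside it, strong induction
   on [l]. *)
suff H m : forall i, i <= b + m%:Z -> forall l : 'I_N, (l.+1 < N)%N -> n i l = n' i l.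
  by apply: (H `|(i - b)%R|%N) => //; lia.
elim: m => [|m IHm] {l lN}{}i im l; first by move=> _; apply: nb; lia.
have [r] := ubnP (l : nat); elim: r l => // r IHr l lr lN.
have N0 : (0 < N)%N by lia.
(* For [a = l + 1] the longest counted intervals starting at [i] are those of length [l + 1], the
   term [t = 0] isolated below. *)
have := @eq_amp l.+1 i; rewrite /amp_count.
rewrite (bigD1 (Ordinal N0, l)) // [in RHS](bigD1 (Ordinal N0, l)) //=.
have -> : amp_cond l.+1 (Ordinal N0) l by rewrite /amp_cond /=; lia.
rewrite subr0 => /(_ ltac:(lia)) e; apply/eqP.
rewrite -(eqn_add2r (\sum_(p | p != (Ordinal N0, l))
  if amp_cond l.+1 p.1 p.2 then n (i - (p.1 : nat)%:Z)%R p.2 else 0)%N).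
rewrite {}e eqn_add2l; apply/eqP; apply: eq_bigr => -[t l'] /= ne.
case: ifP => //; rewrite /amp_cond => /andP[tl tN].
(* For [t > 0] the interval starts before [i], and [l' <= l + t <= N - 2], so the outer hypothesis
   applies. For [t = 0] the condition gives [l' <= l], and [l' = l] is the excluded term. *)
have [t0|t0] := posnP t; last by apply/esym/IHm; lia.
rewrite t0 subr0; apply/esym/IHr; last by lia.
have : (l' : nat) != l.
  by apply: contra ne => /eqP/val_inj->; apply/eqP; congr pair; apply: val_inj.
by lia.
Qed.

Theorem theorem3p8 (N : nat) (k : fieldType) (M M' : fd_ncomplex k N)
    (n n' : int -> 'I_N -> nat) :
  (0 < N)%N ->
  (exists b : int, forall i : int, i <= b -> forall x : M i, x = 0) ->
  (exists b : int, forall i : int, i <= b -> forall x : M' i, x = 0) ->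
  (forall P : ncomplex k N, nc_projective P -> nc_summand P M -> nc_zero P) ->
  (forall P : ncomplex k N, nc_projective P -> nc_summand P M' -> nc_zero P) ->
  (forall (a : nat) (i : int), (1 <= a <= N - 1)%N ->
    \dim {: amp_cohomology M a i} = \dim {: amp_cohomology M' a i}) ->
  nc_multiplicities M n -> nc_multiplicities M' n' ->
  forall (i : int) (l : 'I_N), n i l = n' i l.
Proof.
move=> _ [b Mb] [b' Mb'] noproj noproj' eq_dim Mn Mn' i l.
have [lN|Nl] := ltnP l.+1 N; last first.
  have lN : l.+1 = N by have := ltn_ord l; lia.
  by rewrite (multiplicity_top _ noproj Mn lN) (multiplicity_top _ noproj' Mn' lN).
(* Up to the smaller bound both complexes vanish, hence so do both families, which starts the
   induction. *)
apply: (@amp_count_inj _ _ _ (Num.min b b')) lN.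
  move=> j m; rewrite le_min => /andP[jb jb'].
  by rewrite (multiplicity_below _ Mn (Mb _ jb)) (multiplicity_below _ Mn' (Mb' _ jb')).
have [chi chiP] := coordinates_exist Mn; have [chi' chiP'] := coordinates_exist Mn'.
by move=> a j aN; rewrite -(dim_amp_cohomology chiP) // eq_dim // (dim_amp_cohomology chiP').
Qed.
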